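(* Let $V_{k\to j}(x_k,x_j)$ and $V_{j\to i}(x_j,x_i)$ be two elements of the dual form defined in the context, with parameters $(A_{k,j},b_{k,j},C_{k,j},\eta_{k,j},J_{k,j})$ and $(A_{j,i},b_{j,i},C_{j,i},\eta_{j,i},J_{j,i})$ respectively. Then their combination $$V_{k\to i}(x_k,x_i)=\min_{x_j\in\mathbb R^{n_x}}\left\{V_{k\to j}(x_k,x_j)+V_{j\to i}(x_j,x_i)\right\}$$ is again of the dual form, with parameters $$\begin{aligned} A_{k,i}&=A_{j,i}(I+C_{k,j}J_{j,i})^{-1}A_{k,j},\\ b_{k,i}&=A_{j,i}(I+C_{k,j}J_{j,i})^{-1}(b_{k,j}+C_{k,j}\eta_{j,i})+b_{j,i},\\ C_{k,i}&=A_{j,i}(I+C_{k,j}J_{j,i})^{-1}C_{k,j}A_{j,i}^\top+C_{j,i},\\ \eta_{k,i}&=A_{k,j}^\top(I+J_{j,i}C_{k,j})^{-1}(\eta_{j,i}-J_{j,i}b_{k,j})+\eta_{k,j},\\ J_{k,i}&=A_{k,j}^\top(I+J_{j,i}C_{k,j})^{-1}J_{j,i}A_{k,j}+J_{k,j}, \end{aligned}$$ where $I$ is the identity matrix of size $n_x$.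
   Context: An element $V_{k\to i}:\mathbb R^{n_x}\times\mathbb R^{n_x}\to(-\infty,+\infty]$ is of the dual form with parameters $(A_{k,i},b_{k,i},C_{k,i},\eta_{k,i},J_{k,i})$ if $$V_{k\to i}(x_k,x_i)=\max_{\lambda\in\mathbb R^{n_x}}g_{k\to i}(\lambda;x_k,x_i),$$ $$g_{k\to i}(\lambda;x_k,x_i)=\mathrm z+\tfrac12x_k^\top J_{k,i}x_k-x_k^\top\eta_{k,i}-\tfrac12\lambda^\top C_{k,i}\lambda-\lambda^\top(x_i-A_{k,i}x_k-b_{k,i}),$$ where $A_{k,i},C_{k,i},J_{k,i}\in\mathbb R^{n_x\times n_x}$, $b_{k,i},\eta_{k,i}\in\mathbb R^{n_x}$, $C_{k,i}$ and $J_{k,i}$ are symmetric positive semidefinite, and $\mathrm z$ is an undetermined real constant (not depending on $\lambda,x_k,x_i$, possibly different for different elements). $C_{k,i}$ need not be invertible. Maxima and minima are read as suprema and infima in the extended reals (so the value may be $+\infty$). Such elements arise as conditional value functions of linear quadratic tracking problems with affine dynamics, state weights $X_n\ge0$ and control weights $U_n>0$. *)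

(* Defs.v *)
From mathcomp Require Import all_boot all_order all_algebra.
From mathcomp Require Import all_classical all_reals all_analysis.

Set Implicit Arguments.
Unset Strict Implicit.
Unset Printing Implicit Defensive.

Import Order.TTheory GRing.Theory Num.Theory.
Local Open Scope classical_set_scope.
Local Open Scope ring_scope.

Definition sympsd (R : realType) (n : nat) (M : 'M[R]_n) : Prop :=
  M \is symmetricmx /\ forall x : 'cV[R]_n, 0 <= (x^T *m M *m x) 0 0.

Definition dual_obj (R : realType) (n : nat) (A : 'M[R]_n) (b : 'cV[R]_n)
    (C : 'M[R]_n) (eta : 'cV[R]_n) (J : 'M[R]_n) (z : R)
    (lam xk xi : 'cV[R]_n) : R :=
  z + 2^-1 * (xk^T *m J *m xk) 0 0 - (xk^T *m eta) 0 0
    - 2^-1 * (lam^T *m C *m lam) 0 0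
    - (lam^T *m (xi - A *m xk - b)) 0 0.

(* The maximum over lambda is a supremum in \bar R; it is a supremum over a
   nonempty family of reals, so V never takes the value -oo.  The constant z is
   not one of the parameters, but it is uniform in xk and xi. *)
Definition dual_form (R : realType) (n : nat)
    (V : 'cV[R]_n -> 'cV[R]_n -> \bar R)
    (A : 'M[R]_n) (b : 'cV[R]_n) (C : 'M[R]_n) (eta : 'cV[R]_n)
    (J : 'M[R]_n) : Prop :=
  [/\ sympsd C, sympsd J &
      exists z : R, forall xk xi : 'cV[R]_n,
        V xk xi =
        ereal_sup (range (fun lam => (dual_obj A b C eta J z lam xk xi)%:E))].

(* The minimum over xj is an infimum in \bar R.  For V1, V2 of dual form neither
   summand is -oo, so the indeterminate sum (+oo) + (-oo) does not occur. *)
Definition combine (R : realType) (n : nat)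
    (V1 V2 : 'cV[R]_n -> 'cV[R]_n -> \bar R) (xk xi : 'cV[R]_n) : \bar R :=
  ereal_inf (range (fun xj : 'cV[R]_n => (V1 xk xj + V2 xj xi)%E)).

(* Main.v *)
(* For a multiplier lam of the second element put w = eta_ji - A_ji^T lam and
   m = A_kj xk + b_kj.  The sum of the two dual objectives, as a function of xj
   and of the multiplier of the first element, has the saddle point
   xs = (I + C_kj J_ji)^-1 (m + C_kj w), ls = J_ji xs - w.  Taking ls as the first
   multiplier, the sum equals the claimed dual objective at lam plus
   1/2 (xj - xs)^T J_ji (xj - xs); this gives weak duality.  Conversely, if the
   residual of the combined element lies in the range of C_ki, the combined
   supremum is attained at some lam, and at xj = xs the multipliers ls and lam
   maximize the two separate objectives; otherwise a kernel direction of C_ki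
   makes the combined supremum +oo. *)
Require Import Defs.
From mathcomp Require Import all_boot all_order all_algebra.
From mathcomp Require Import all_classical all_reals all_analysis.
From mathcomp Require Import lra.

Set Implicit Arguments.
Unset Strict Implicit.
Unset Printing Implicit Defensive.

Import Order.TTheory GRing.Theory Num.Theory.
Local Open Scope ring_scope.

(** * Inner product of column vectors *)

Definition dot (R : realType) (n : nat) (u v : 'cV[R]_n) : R := (u^T *m v) 0 0.

Lemma dotC (R : realType) (n : nat) (u v : 'cV[R]_n) : dot u v = dot v u.
Proof. by rewrite /dot -[u^T *m v]trmxK trmx_mul trmxK mxE. Qed.

Lemma dotDr (R : realType) (n : nat) (u v w : 'cV[R]_n) :
  dot u (v + w) = dot u v + dot u w.
Proof. by rewrite /dot mulmxDr mxE. Qed.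

Lemma dotNr (R : realType) (n : nat) (u v : 'cV[R]_n) : dot u (- v) = - dot u v.
Proof. by rewrite /dot mulmxN mxE. Qed.

Lemma dotZr (R : realType) (n : nat) (a : R) (u v : 'cV[R]_n) :
  dot u (a *: v) = a * dot u v.
Proof. by rewrite /dot -scalemxAr mxE. Qed.

Lemma dotDl (R : realType) (n : nat) (u v w : 'cV[R]_n) :
  dot (u + v) w = dot u w + dot v w.
Proof. by rewrite dotC dotDr !(dotC w). Qed.

Lemma dotNl (R : realType) (n : nat) (u v : 'cV[R]_n) : dot (- u) v = - dot u v.
Proof. by rewrite dotC dotNr dotC. Qed.

Lemma dotZl (R : realType) (n : nat) (a : R) (u v : 'cV[R]_n) :
  dot (a *: u) v = a * dot u v.
Proof. by rewrite dotC dotZr dotC. Qed.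

Lemma dot0r (R : realType) (n : nat) (u : 'cV[R]_n) : dot u 0 = 0.
Proof. by rewrite /dot mulmx0 mxE. Qed.

Definition dotE := (dotDr, dotDl, dotNr, dotNl, dotZr, dotZl).

Lemma dot_mulmx (R : realType) (n : nat) (A : 'M[R]_n) (u v : 'cV[R]_n) :
  dot u (A *m v) = dot v (A^T *m u).
Proof. by rewrite dotC /dot trmx_mul mulmxA. Qed.

Lemma dot_ge0 (R : realType) (n : nat) (u : 'cV[R]_n) : 0 <= dot u u.
Proof. by rewrite /dot mxE sumr_ge0// => i _; rewrite mxE -expr2 sqr_ge0. Qed.

Lemma dot_eq0 (R : realType) (n : nat) (u : 'cV[R]_n) : dot u u = 0 -> u = 0.
Proof.
rewrite /dot mxE => /eqP; rewrite psumr_eq0; last first.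
  by move=> i _; rewrite mxE -expr2 sqr_ge0.
move=> /allP h; apply/matrixP => i j; rewrite ord1 mxE.
have := h i (mem_index_enum i).
by rewrite mxE -expr2 sqrf_eq0 => /eqP.
Qed.

Lemma dual_objE (R : realType) (n : nat) (A : 'M[R]_n) (b : 'cV[R]_n)
    (C : 'M[R]_n) (eta : 'cV[R]_n) (J : 'M[R]_n) (z : R)
    (lam xk xi : 'cV[R]_n) :
  dual_obj A b C eta J z lam xk xi =
  z + 2^-1 * dot xk (J *m xk) - dot xk eta - 2^-1 * dot lam (C *m lam)
    - dot lam (xi - A *m xk - b).
Proof. by rewrite /dual_obj /dot !mulmxA. Qed.

(** * Symmetric positive semidefinite matrices *)

Lemma sympsdP (R : realType) (n : nat) (M : 'M[R]_n) :
  sympsd M <-> M^T = M /\ forall u, 0 <= dot u (M *m u).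
Proof.
have symE : (M \is symmetricmx) = (M^T == M).
  by rewrite is_hermitianmxE expr0 scale1r map_mx_id// eq_sym.
rewrite /sympsd symE; split=> -[/eqP sM pM]; split=> // u.
  by rewrite /dot mulmxA.
by move: (pM u); rewrite /dot mulmxA.
Qed.

Lemma sympsd_dotC (R : realType) (n : nat) (M : 'M[R]_n) (u v : 'cV[R]_n) :
  sympsd M -> dot u (M *m v) = dot v (M *m u).
Proof. by move=> /sympsdP[sM _]; rewrite dot_mulmx sM. Qed.

Lemma sympsd_eq0 (R : realType) (n : nat) (M : 'M[R]_n) (u : 'cV[R]_n) :
  sympsd M -> dot u (M *m u) = 0 -> M *m u = 0.
Proof.
move=> hM u0; apply: dot_eq0; have /sympsdP[_ pM] := hM.
set v := M *m u in u0 *.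
have v0 : 0 <= dot v v := dot_ge0 v.
have q0 := pM v; set q := dot v (M *m v) in q0.
(* The quadratic form at [(q + 1) u - (v.v) v] equals [- (v.v)^2 (q + 2)]. *)
have := pM ((q + 1) *: u - dot v v *: v).
rewrite mulmxDr mulmxN -!scalemxAr !dotE (sympsd_dotC u v hM) -/v -/q u0.
set d := dot v v in v0 * => h.
have {}h : d ^+ 2 * (q + 2) <= 0 by nra.
have : d ^+ 2 <= 0 by rewrite -(@pmulr_lle0 _ (q + 2)) //; lra.
by rewrite le_eqVlt ltNge sqr_ge0 orbF sqrf_eq0 => /eqP.
Qed.

(** If [x = - C J x], pairing with [J x] gives [(J x)' C (J x) = - x' J x]. Both forms are
    nonnegative, so both vanish; hence [C (J x) = 0] and [x = 0]. *)
Lemma sympsd_unit (R : realType) (n : nat) (C J : 'M[R]_n) :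
  sympsd C -> sympsd J -> 1%:M + C *m J \in unitmx.
Proof.
move=> hC hJ; have [/sympsdP[_ pC] /sympsdP[_ pJ]] := (hC, hJ).
rewrite -unitmx_tr -row_free_unit -kermx_eq0; apply/eqP/row_matrixP => i.
rewrite row0; apply: trmx_inj; rewrite trmx0; set x := (row i _)^T.
have hx : x = - (C *m (J *m x)).
  apply/eqP; rewrite -addr_eq0 mulmxA -{1}[x]mul1mx -mulmxDl; apply/eqP.
  by apply: trmx_inj; rewrite trmx_mul trmxK -row_mul mulmx_ker row0 trmx0.
have h : dot (J *m x) (C *m (J *m x)) = - dot x (J *m x).
  by rewrite [X in - dot X _]hx dotNl opprK dotC.
rewrite hx (sympsd_eq0 hC) ?oppr0 //.
by have := pC (J *m x); have := pJ x; lra.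
Qed.

(** The push-through identity [M C = C N] gives symmetry. With [y = N u], so that [u = y + J C y],
    it also gives [u' M C u = y' C y + (C y)' J (C y)]. *)
Lemma sympsd_resolvent (R : realType) (n : nat) (C J : 'M[R]_n) :
  sympsd C -> sympsd J -> sympsd (invmx (1%:M + C *m J) *m C).
Proof.
move=> hC hJ; have [/sympsdP[sC pC] /sympsdP[sJ pJ]] := (hC, hJ).
have uM := sympsd_unit hC hJ; have uN := sympsd_unit hJ hC.
set M := invmx _; set N := invmx (1%:M + J *m C).
have MT : M^T = N by rewrite trmx_inv linearD /= trmx1 trmx_mul sC sJ.
have MC : M *m C = C *m N.
  have e : C *m (1%:M + J *m C) = (1%:M + C *m J) *m C.
    by rewrite mulmxDr mulmxDl mulmx1 mul1mx mulmxA.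
  by apply: (canLR (mulKmx uM)); rewrite mulmxA -e mulmxK.
apply/sympsdP; split=> [|u]; first by rewrite trmx_mul sC MT -MC.
set y := N *m u.
have uE : u = y + J *m (C *m y).
  by rewrite mulmxA -{1}[y]mul1mx -mulmxDl mulKVmx.
rewrite MC -mulmxA -/y {1}uE dotDl [dot (J *m _) _]dotC.
by rewrite addr_ge0.
Qed.

Lemma sympsd_add (R : realType) (n : nat) (C J : 'M[R]_n) :
  sympsd C -> sympsd J -> sympsd (C + J).
Proof.
move=> /sympsdP[sC pC] /sympsdP[sJ pJ]; apply/sympsdP; split=> [|u].
  by rewrite linearD /= sC sJ.
by rewrite mulmxDl dotDr addr_ge0.
Qed.

Lemma sympsd_congr (R : realType) (n : nat) (A C : 'M[R]_n) :
  sympsd C -> sympsd (A *m C *m A^T).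
Proof.
move=> /sympsdP[sC pC]; apply/sympsdP; split=> [|u].
  by rewrite !trmx_mul trmxK sC mulmxA.
by rewrite -!mulmxA dot_mulmx dotC.
Qed.

(** Fredholm alternative: by symmetry the range of [C] is its row space. A vector outside it pairs
    nontrivially with some column of the cokernel matrix; that column lies in the kernel of [C] and
    can be rescaled. *)
Lemma sympsd_range (R : realType) (n : nat) (C : 'M[R]_n) (r : 'cV[R]_n) :
  sympsd C ->
  (exists l, r = - (C *m l)) \/ (exists v, C *m v = 0 /\ dot v r = 1).
Proof.
move=> /sympsdP[sC _]; have [/submxP[D rD]|] := boolP (r^T <= C)%MS.
  left; exists (- D^T); apply: trmx_inj.
  by rewrite mulmxN opprK trmx_mul trmxK sC.
rewrite submxE => rK; right; have CK := mulmx_coker C.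
move: (cokermx C) rK CK => K /rV0Pn[j rj] CK.
exists (((r^T *m K) 0 j)^-1 *: col j K); split.
  by rewrite -scalemxAr colE [C *m _]mulmxA CK mul0mx scaler0.
have -> : (r^T *m K) 0 j = dot (col j K) r.
  by rewrite dotC /dot colE mulmxA -colE [RHS]mxE.
by rewrite dotZl mulVf // dotC /dot colE mulmxA -colE mxE.
Qed.

(** * Suprema of the dual objective *)

(** Completing the square: the value at [lam0] exceeds the value at [lam] by
    [1/2 (lam - lam0)' C (lam - lam0)]. *)
Lemma dual_obj_argmax (R : realType) (n : nat) (A : 'M[R]_n) (b : 'cV[R]_n)
    (C : 'M[R]_n) (eta : 'cV[R]_n) (J : 'M[R]_n) (z : R)
    (lam0 xk xi : 'cV[R]_n) :
  sympsd C -> xi - A *m xk - b = - (C *m lam0) ->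
  ereal_sup (range (fun lam => (dual_obj A b C eta J z lam xk xi)%:E)) =
  (dual_obj A b C eta J z lam0 xk xi)%:E.
Proof.
move=> hC h; apply/eqP; rewrite eq_le; apply/andP; split; last first.
  by apply: ereal_sup_ubound; exists lam0.
apply: ge_ereal_sup => _ [lam _ <-]; rewrite lee_fin !dual_objE h.
have /sympsdP[_ /(_ (lam - lam0))] := hC.
rewrite mulmxDr mulmxN !dotE (sympsd_dotC lam0 lam hC); lra.
Qed.

(** Along multiples of [v] the quadratic term vanishes and the objective is affine with slope -1. *)
Lemma dual_obj_unbounded (R : realType) (n : nat) (A : 'M[R]_n) (b : 'cV[R]_n)
    (C : 'M[R]_n) (eta : 'cV[R]_n) (J : 'M[R]_n) (z : R)
    (v xk xi : 'cV[R]_n) :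
  C *m v = 0 -> dot v (xi - A *m xk - b) = 1 ->
  ereal_sup (range (fun lam => (dual_obj A b C eta J z lam xk xi)%:E)) = +oo%E.
Proof.
move=> Cv vr; apply/eqyP => t t0.
set c := z + 2^-1 * dot xk (J *m xk) - dot xk eta.
(* At this multiplier the objective is [c - (c - t) = t]. *)
apply: ereal_sup_ge; exists (dual_obj A b C eta J z ((c - t) *: v) xk xi)%:E.
  by exists ((c - t) *: v).
rewrite lee_fin dual_objE -/c -scalemxAr Cv scaler0 dot0r dotZl vr; lra.
Qed.

(* [(xs, ls)] solves the stationarity equations [m - C ls = xs], [ls = J xs - w]
   of the saddle function [- 1/2 l'Cl - l'(x - m) + 1/2 x'Jx - x'w]. *)
Lemma saddle_value (R : realType) (n : nat) (C J : 'M[R]_n)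
    (x m w : 'cV[R]_n) :
  sympsd C -> sympsd J ->
  let xs := invmx (1%:M + C *m J) *m (m + C *m w) in
  let ls := J *m xs - w in
  xs - m = - (C *m ls) /\
  - (2^-1 * dot ls (C *m ls)) - dot ls (x - m) + 2^-1 * dot x (J *m x) - dot x w
  = 2^-1 * dot m (invmx (1%:M + J *m C) *m (J *m m))
    - dot m (invmx (1%:M + J *m C) *m w)
    - 2^-1 * dot w (invmx (1%:M + C *m J) *m (C *m w))
    + 2^-1 * dot (x - xs) (J *m (x - xs)).
Proof.
move=> hC hJ xs ls; have [/sympsdP[sC _] /sympsdP[sJ _]] := (hC, hJ).
have uM := sympsd_unit hC hJ; have uN := sympsd_unit hJ hC.
set M := invmx (1%:M + C *m J) in xs ls *; set N := invmx (1%:M + J *m C).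
have xsE : xs + C *m (J *m xs) = m + C *m w.
  by rewrite mulmxA -{1}[xs]mul1mx -mulmxDl mulKVmx.
have Cls : C *m ls = m - xs.
  by apply/eqP; rewrite mulmxBr subr_eq addrAC -xsE [_ - xs]addrC addKr.
(* Substituting [C ls = m - xs] gives [(1 + J C) ls = J m - w]. *)
have lsE : ls = N *m (J *m m) - N *m w.
  rewrite -mulmxBr; apply: (canRL (mulKmx uN)).
  by rewrite mulmxDl mul1mx -mulmxA Cls mulmxBr addrC /ls addrA subrK.
have Jxs : J *m xs = ls + w by rewrite subrK.
have xsD : xs = M *m m + M *m (C *m w) by rewrite -mulmxDr.
split; first by rewrite Cls opprB.
have MT : M^T = N by rewrite trmx_inv linearD /= trmx1 trmx_mul sC sJ.
have e1 : dot m ls = dot m (N *m (J *m m)) - dot m (N *m w) by rewrite lsE !dotE.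
have e2 : dot w xs = dot m (N *m w) + dot w (M *m (C *m w)).
  by rewrite xsD dotDr (dot_mulmx M) MT.
have e3 := sympsd_dotC xs x hJ.
(* From here [xs] and [ls] are atoms known only through the equations above, and the goal is linear
   in their inner products. *)
clearbody ls xs.
rewrite Cls mulmxBr !dotE e3 Jxs !dotE (dotC ls m) (dotC ls x) (dotC ls xs).
rewrite (dotC xs w) (dotC x w) e2 e1; lra.
Qed.

(** This is the saddle value at [m = A1 xk + b1], with [m] and [w] split into their [xk], [lam] and
    constant parts. Since [xs] does not depend on [x], the final square carries all dependence on
    [x]. *)
Lemma lagrangian (R : realType) (n : nat)
    (A1 : 'M[R]_n) (b1 : 'cV[R]_n) (C1 : 'M[R]_n) (eta1 : 'cV[R]_n)
    (J1 : 'M[R]_n) (z1 : R)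
    (A2 : 'M[R]_n) (b2 : 'cV[R]_n) (C2 : 'M[R]_n) (eta2 : 'cV[R]_n)
    (J2 : 'M[R]_n) (z2 : R) (lam xk x xi : 'cV[R]_n) :
  sympsd C1 -> sympsd J2 ->
  let M := invmx (1%:M + C1 *m J2) in
  let N := invmx (1%:M + J2 *m C1) in
  let w := eta2 - A2^T *m lam in
  let xs := M *m (A1 *m xk + b1 + C1 *m w) in
  dual_obj A1 b1 C1 eta1 J1 z1 (J2 *m xs - w) xk x
    + dual_obj A2 b2 C2 eta2 J2 z2 lam x xi =
  dual_obj (A2 *m M *m A1) (A2 *m M *m (b1 + C1 *m eta2) + b2)
    (A2 *m M *m C1 *m A2^T + C2)
    (A1^T *m N *m (eta2 - J2 *m b1) + eta1) (A1^T *m N *m J2 *m A1 + J1)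
    (z1 + z2 + 2^-1 * dot b1 (N *m (J2 *m b1)) - dot b1 (N *m eta2)
       - 2^-1 * dot eta2 (M *m (C1 *m eta2))) lam xk xi
  + 2^-1 * dot (x - xs) (J2 *m (x - xs)).
Proof.
move=> hC hJ M N w xs; have [/sympsdP[sC _] /sympsdP[sJ _]] := (hC, hJ).
have [_] := saddle_value x (A1 *m xk + b1) w hC hJ.
rewrite -/M -/N -/xs !dual_objE; set a := A1 *m xk; set l := A2^T *m lam.
set q := dot (x - xs) _; set ls := _ - w => core.
have MT : M^T = N by rewrite trmx_inv linearD /= trmx1 trmx_mul sC sJ.
have MTV u v : dot u (M *m v) = dot v (N *m u) by rewrite dot_mulmx MT.
have Q u v : dot u (M *m (C1 *m v)) = dot v (M *m (C1 *m u)).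
  by rewrite !mulmxA; apply/sympsd_dotC/sympsd_resolvent.
have P u v : dot u (N *m (J2 *m v)) = dot v (N *m (J2 *m u)).
  by rewrite !mulmxA; apply/sympsd_dotC/sympsd_resolvent.
have A1V u : dot xk (A1^T *m u) = dot a u by rewrite dot_mulmx trmxK dotC.
have A2V u : dot lam (A2 *m u) = dot l u by rewrite dot_mulmx dotC.
have -> : dot xk ((A1^T *m N *m J2 *m A1 + J1) *m xk) =
    dot a (N *m (J2 *m a)) + dot xk (J1 *m xk).
  by rewrite mulmxDl dotDr -!mulmxA A1V.
have -> : dot xk (A1^T *m N *m (eta2 - J2 *m b1) + eta1) =
    dot a (N *m eta2) - dot a (N *m (J2 *m b1)) + dot xk eta1.
  by rewrite dotDr -!mulmxA A1V mulmxBr !dotE.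
have -> : dot lam ((A2 *m M *m C1 *m A2^T + C2) *m lam) =
    dot l (M *m (C1 *m l)) + dot lam (C2 *m lam).
  by rewrite mulmxDl dotDr -!mulmxA A2V.
have -> : dot lam (xi - A2 *m M *m A1 *m xk - (A2 *m M *m (b1 + C1 *m eta2) + b2))
    = dot lam xi - dot a (N *m l)
      - (dot b1 (N *m l) + dot l (M *m (C1 *m eta2)) + dot lam b2).
  by rewrite -!mulmxA !dotE !A2V mulmxDr dotDr !MTV.
have -> : dot lam (xi - A2 *m x - b2) = dot lam xi - dot l x - dot lam b2.
  by rewrite !dotE A2V.
have -> : dot ls (x - a - b1) = dot ls (x - (a + b1)) by rewrite opprD addrA.
(* These symmetries identify the cross terms that occur in both orders, so that linear arithmetic
   suffices. *)
have := P a b1; have := Q eta2 l; have := dotC x l.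
move: core; rewrite /w -/l.
clearbody q ls.
rewrite !(mulmxDr, mulmxN) !dotE.
lra.
Qed.

(* invmx M is the inverse of M only when M \in unitmx (it is M otherwise), so
   the conclusion also asserts that the inverses in the formulas exist. *)
Theorem lemma10 (R : realType) (n : nat)
    (Vkj Vji : 'cV[R]_n -> 'cV[R]_n -> \bar R)
    (Akj : 'M[R]_n) (bkj : 'cV[R]_n) (Ckj : 'M[R]_n) (etakj : 'cV[R]_n)
    (Jkj : 'M[R]_n)
    (Aji : 'M[R]_n) (bji : 'cV[R]_n) (Cji : 'M[R]_n) (etaji : 'cV[R]_n)
    (Jji : 'M[R]_n)
    (hkj : dual_form Vkj Akj bkj Ckj etakj Jkj)
    (hji : dual_form Vji Aji bji Cji etaji Jji) :
  [/\ 1%:M + Ckj *m Jji \in unitmx,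
      1%:M + Jji *m Ckj \in unitmx &
      dual_form (combine Vkj Vji)
        (Aji *m invmx (1%:M + Ckj *m Jji) *m Akj)
        (Aji *m invmx (1%:M + Ckj *m Jji) *m (bkj + Ckj *m etaji) + bji)
        (Aji *m invmx (1%:M + Ckj *m Jji) *m Ckj *m Aji^T + Cji)
        (Akj^T *m invmx (1%:M + Jji *m Ckj) *m (etaji - Jji *m bkj) + etakj)
        (Akj^T *m invmx (1%:M + Jji *m Ckj) *m Jji *m Akj + Jkj)].
Proof.
have [hC1 hJ1 [z1 V1E]] := hkj; have [hC2 hJ2 [z2 V2E]] := hji.
split; [exact: sympsd_unit|exact: sympsd_unit|].
set M := invmx (1%:M + Ckj *m Jji); set N := invmx (1%:M + Jji *m Ckj).
have hC : sympsd (Aji *m M *m Ckj *m Aji^T + Cji).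
  apply: sympsd_add => //; rewrite -(mulmxA Aji).
  exact/sympsd_congr/sympsd_resolvent.
split=> //.
  apply: sympsd_add => //; rewrite -(mulmxA Akj^T) -{2}[Akj]trmxK.
  exact/sympsd_congr/sympsd_resolvent.
(* The constant is [z1 + z2] plus the saddle value for [xk = 0] and [lam = 0], that is, [m = bkj]
   and [w = etaji]. *)
exists (z1 + z2 + 2^-1 * dot bkj (N *m (Jji *m bkj)) - dot bkj (N *m etaji)
  - 2^-1 * dot etaji (M *m (Ckj *m etaji))) => xk xi; rewrite /combine.
pose ws lam := etaji - Aji^T *m lam.
pose xs lam := M *m (Akj *m xk + bkj + Ckj *m ws lam).
have L x lam := lagrangian Akj bkj etakj Jkj z1 Aji bji Cji etaji z2
  lam xk x xi hC1 hJ2.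
apply/eqP; rewrite eq_le; apply/andP; split; last first.
  apply: ge_ereal_sup => _ [lam _ <-]; apply: le_ereal_inf_tmp => _ [x _ <-].
  rewrite V1E V2E.
  apply: (@le_trans _ _ ((dual_obj Akj bkj Ckj etakj Jkj z1
      (Jji *m xs lam - ws lam) xk x)%:E +
    (dual_obj Aji bji Cji etaji Jji z2 lam x xi)%:E)%E); last first.
    by apply: leeD; apply: ereal_sup_ubound;
      [exists (Jji *m xs lam - ws lam)|exists lam].
  rewrite -EFinD lee_fin L lerDl mulr_ge0 //.
  by have /sympsdP[_] := hJ2.
set A := Aji *m M *m Akj; set b := _ + bji.
have [[lam rE]|[v [Cv vr]]] := sympsd_range (xi - A *m xk - b) hC; last first.
  by rewrite (dual_obj_unbounded _ _ _ Cv vr) leey.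
rewrite (dual_obj_argmax _ _ _ hC rE).
apply: ge_ereal_inf; exists (Vkj xk (xs lam) + Vji (xs lam) xi)%E.
  by exists (xs lam).
have [xsm _] := saddle_value 0 (Akj *m xk + bkj) (ws lam) hC1 hJ2.
rewrite opprD addrA in xsm.
(* The residual of the second element at [xs lam] is the combined residual plus the part of the
   combined [C] that comes from [Ckj], applied to [lam]; by [rE] only [- Cji lam] survives. *)
have xsi : xi - Aji *m xs lam - bji = - (Cji *m lam).
  have -> : xi - Aji *m xs lam - bji =
      (xi - A *m xk - b) + Aji *m M *m Ckj *m Aji^T *m lam.
    rewrite /A /b /xs /ws !(mulmxDr, mulmxN, mulmxA, opprD, opprK) !addrA.
    by rewrite [RHS]addrAC.
  by rewrite rE mulmxDl opprD addrAC addNr add0r.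
rewrite V1E V2E (dual_obj_argmax _ _ _ hC1 xsm) (dual_obj_argmax _ _ _ hC2 xsi).
(* At [x = xs lam] the square in [L] vanishes, so there is no duality gap. *)
rewrite -EFinD lee_fin (L (xs lam)).
by rewrite subrr mulmx0 dot0r mulr0 addr0.
Qed.
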